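(* Consider $\min_{x\in\mathbb{R}^d} f(x)$ with $f(x)=\mathcal{L}(Ax,b)=\frac1s\sum_{j=1}^s\mathcal{L}_j(A_j^Tx,b_j)$. Suppose that each $\mathcal{L}_j$ (as a function of $x\in\mathbb{R}^d$) is $L$-smooth for some $L>0$ and that $\mathcal{L}$ (as a function of $x$) is $\mu$-strongly convex for some $\mu>0$. Let $\widetilde L=\max\left\{L,\frac{\bar L}{K}\right\}$ and let $x^*$ be the solution of the problem. Then the iterates of the algorithm DVPL-Katyusha satisfy, at every iteration $k$, $$\mathbb{E}\left[\mathbb{Z}^{k+1}+\mathbb{Y}^{k+1}+\mathbb{W}^{k+1}\right]\le\frac1{1+\eta\sigma}\mathbb{Z}^k+\bigl(1-\theta_1(1-\theta_2)\bigr)\mathbb{Y}^k+\left(1-\frac{p\theta_1}{1+\theta_1}\right)\mathbb{W}^k,$$ where $$\mathbb{Z}^k=\frac{\widetilde L(1+\eta\sigma)}{2\eta}\|z^k-x^*\|^2,\qquad\mathbb{Y}^k=\frac1{\theta_1}\bigl(f(y^k)-f(x^* )\bigr),\qquad\mathbb{W}^k=\frac{\theta_2(1+\theta_1)}{p\theta_1}\bigl(f(w^k)-f(x^* )\bigr),$$ and the expectation on the left is over the randomness of iteration $k$, given the iterates $z^k,y^k,w^k$.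
   Context: $A\in\mathbb{R}^{s\times d}$ is a feature matrix with $s$ samples and $d$ features, $A_j$ its $j$-th row (viewed as a vector, $A_j^Tx$ is the dot product), $b\in\mathbb{R}^s$ the targets. A function $h$ is $L$-smooth if $h(y)\le h(x)+\langle\nabla h(x),y-x\rangle+\frac L2\|y-x\|^2$ for all $x,y\in\mathbb{R}^d$, and $\mu$-strongly convex if $h(y)\ge h(x)+\langle\nabla h(x),y-x\rangle+\frac\mu2\|y-x\|^2$ for all $x,y\in\mathbb{R}^d$. $L_j$ is the smoothness (Lipschitz gradient) constant of $x\mapsto\mathcal{L}_j(A_j^Tx,b_j)$ and $\bar L=\frac1s\sum_{j=1}^sL_j$. All gradients are with respect to $x$. DVPL-Katyusha (features are split among $n$ workers, each storing and updating its own block of coordinates; written here for full vectors): $K$ is the number of samples drawn per iteration; parameters $\theta_1,\theta_2\in\mathbb{R}$, $p\in(0,1]$, step size $\eta=\frac{\theta_2}{(1+\theta_2)\theta_1}$, $\sigma=\frac{K\mu}{\bar L}$ if $\frac{\bar L}{K}\ge L$ and $\sigma=\frac\mu L$ otherwise (i.e. $\sigma=\mu/\widetilde L$ with $\widetilde L=\max\{L,\bar L/K\}$). Start with $y^0=w^0=z^0\in\mathbb{R}^d$. For $k=0,1,2,\dots$: $x^k=\theta_1z^k+\theta_2w^k+(1-\theta_1-\theta_2)y^k$; draw a collection $J^k$ of $K$ indices independently, each equal to $j\in\{1,\dots,s\}$ with probability $p_j=\frac{L_j}{s\bar L}$ (same seed on all workers); $g^k=\frac1K\sum_{j\in J^k}\frac1{sp_j}\left[\nabla\mathcal{L}_j(A_j^Tx^k,b_j)-\nabla\mathcal{L}_j(A_j^Tw^k,b_j)\right]+\nabla\mathcal{L}(Aw^k,b)$;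 $z^{k+1}=\frac1{1+\eta\sigma}\left(\eta\sigma x^k+z^k-\frac\eta{\widetilde L}g^k\right)$; $y^{k+1}=x^k+\theta_1(z^{k+1}-z^k)$; $w^{k+1}=y^k$ with probability $p$, and $w^{k+1}=w^k$ with probability $1-p$ (independently of $J^k$).
   Formalization: Each loss L_j is additionally assumed convex as a function of x, and the parameters are assumed to satisfy θ1 > 0, θ2 > 0 and θ1 + θ2 ≤ 1; without these the inequality is false or undefined. *)

(* Defs.v *)
From HB Require Import structures.
From mathcomp Require Import all_boot all_order all_algebra.
From mathcomp Require Import all_classical all_reals all_analysis.

Set Implicit Arguments.
Unset Strict Implicit.
Unset Printing Implicit Defensive.

Import Order.TTheory GRing.Theory Num.Theory.
Import numFieldNormedType.Exports.

Local Open Scope ring_scope.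

(* The library norm on matrices is the sup norm (it induces the topology used
   by [differentiable]); the geometry below is Euclidean. *)
Definition dotv (R : realType) (d : nat) (u v : 'cV[R]_d) : R :=
  (u^T *m v) 0 0.

Definition enorm (R : realType) (d : nat) (u : 'cV[R]_d) : R :=
  Num.sqrt (dotv u u).

Definition grad (R : realType) (d : nat) (h : 'cV[R]_d -> R) (x : 'cV[R]_d) :
    'cV[R]_d :=
  \col_(i < d) 'D_(delta_mx i 0) h x.

Definition smooth (R : realType) (d : nat) (L : R) (h : 'cV[R]_d -> R) : Prop :=
  (forall x, differentiable h x) /\
  forall x y, h y <= h x + dotv (grad h x) (y - x) + L / 2 * enorm (y - x) ^+ 2.

Definition strongly_convex (R : realType) (d : nat) (mu : R)
    (h : 'cV[R]_d -> R) : Prop :=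
  (forall x, differentiable h x) /\
  forall x y, h x + dotv (grad h x) (y - x) + mu / 2 * enorm (y - x) ^+ 2 <= h y.

Definition lipschitz_gradient (R : realType) (d : nat) (L : R)
    (h : 'cV[R]_d -> R) : Prop :=
  [/\ 0 <= L, forall x, differentiable h x &
      forall x y, enorm (grad h y - grad h x) <= L * enorm (y - x)].

(* [(A *m x) j 0] is the dot product of the j-th row of A with x. *)
Definition sample_loss (R : realType) (s d : nat) (A : 'M[R]_(s, d))
    (b : 'cV[R]_s) (loss : 'I_s -> R -> R -> R) (j : 'I_s) (x : 'cV[R]_d) : R :=
  loss j ((A *m x) j 0) (b j 0).

Definition objective (R : realType) (s d : nat) (A : 'M[R]_(s, d))
    (b : 'cV[R]_s) (loss : 'I_s -> R -> R -> R) (x : 'cV[R]_d) : R :=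
  s%:R^-1 * \sum_(j < s) sample_loss A b loss j x.

Definition Lbar (R : realType) (s : nat) (Lj : 'I_s -> R) : R :=
  s%:R^-1 * \sum_(j < s) Lj j.

Definition Ltilde (R : realType) (s K : nat) (L : R) (Lj : 'I_s -> R) : R :=
  Num.max L (Lbar Lj / K%:R).

Definition sigma_param (R : realType) (s K : nat) (L mu : R) (Lj : 'I_s -> R) : R :=
  if L <= Lbar Lj / K%:R then K%:R * mu / Lbar Lj else mu / L.

Definition step_size (R : realType) (theta1 theta2 : R) : R :=
  theta2 / ((1 + theta2) * theta1).

(* If j has [sampling_prob Lj j = 0], the weight (s p_j)^-1 in [estimator] is
   the conventional 0; such a j has probability 0 of being drawn. *)
Definition sampling_prob (R : realType) (s : nat) (Lj : 'I_s -> R) (j : 'I_s) : R :=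
  Lj j / (s%:R * Lbar Lj).

Record iterates (R : realType) (d : nat) :=
  Iterates { zit : 'cV[R]_d; yit : 'cV[R]_d; wit : 'cV[R]_d }.

Definition xit (R : realType) (d : nat) (theta1 theta2 : R)
    (S : iterates R d) : 'cV[R]_d :=
  theta1 *: zit S + theta2 *: wit S + (1 - theta1 - theta2) *: yit S.

Definition estimator (R : realType) (s d K : nat) (A : 'M[R]_(s, d))
    (b : 'cV[R]_s) (loss : 'I_s -> R -> R -> R) (Lj : 'I_s -> R)
    (J : {ffun 'I_K -> 'I_s}) (x w : 'cV[R]_d) : 'cV[R]_d :=
  K%:R^-1 *: \sum_(i < K)
     (s%:R * sampling_prob Lj (J i))^-1 *:
       (grad (sample_loss A b loss (J i)) x - grad (sample_loss A b loss (J i)) w)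
  + grad (objective A b loss) w.

(* One iteration, as a deterministic function of the random draws: J lists the
   K sampled indices, and c = true is the event w^{k+1} = y^k. *)
Definition katyusha_step (R : realType) (s d K : nat) (A : 'M[R]_(s, d))
    (b : 'cV[R]_s) (loss : 'I_s -> R -> R -> R) (L mu : R) (Lj : 'I_s -> R)
    (theta1 theta2 : R) (S : iterates R d)
    (J : {ffun 'I_K -> 'I_s}) (c : bool) : iterates R d :=
  let x := xit theta1 theta2 S in
  let g := estimator A b loss Lj J x (wit S) in
  let es := step_size theta1 theta2 * sigma_param K L mu Lj in
  let z' := (1 + es)^-1 *:
    (es *: x + zit S - (step_size theta1 theta2 / Ltilde K L Lj) *: g) in
  let y' := x + theta1 *: (z' - zit S) in
  Iterates z' y' (if c then yit S else wit S).

(* The iterates z^k, y^k, w^k along the sample path with draws J 0, J 1, ...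
   and coins c 0, c 1, ... *)
Fixpoint katyusha_iter (R : realType) (s d K : nat) (A : 'M[R]_(s, d))
    (b : 'cV[R]_s) (loss : 'I_s -> R -> R -> R) (L mu : R) (Lj : 'I_s -> R)
    (theta1 theta2 : R) (x0 : 'cV[R]_d)
    (J : nat -> {ffun 'I_K -> 'I_s}) (c : nat -> bool) (k : nat) : iterates R d :=
  if k is k'.+1 then
    katyusha_step A b loss L mu Lj theta1 theta2
      (katyusha_iter A b loss L mu Lj theta1 theta2 x0 J c k') (J k') (c k')
  else Iterates x0 x0 x0.

(* Expectation over the randomness of one iteration: the K indices are i.i.d.
   with law [sampling_prob Lj], and the coin is an independent Bernoulli(p). *)
Definition iteration_expectation (R : realType) (s K : nat) (Lj : 'I_s -> R)
    (p : R) (F : {ffun 'I_K -> 'I_s} -> bool -> R) : R :=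
  \sum_(J : {ffun 'I_K -> 'I_s})
     (\prod_(i < K) sampling_prob Lj (J i)) *
     (p * F J true + (1 - p) * F J false).

Definition Zpot (R : realType) (s d K : nat) (L mu : R) (Lj : 'I_s -> R)
    (theta1 theta2 : R) (xstar : 'cV[R]_d) (S : iterates R d) : R :=
  Ltilde K L Lj * (1 + step_size theta1 theta2 * sigma_param K L mu Lj)
    / (2 * step_size theta1 theta2) * enorm (zit S - xstar) ^+ 2.

Definition Ypot (R : realType) (d : nat) (f : 'cV[R]_d -> R) (theta1 : R)
    (xstar : 'cV[R]_d) (S : iterates R d) : R :=
  theta1^-1 * (f (yit S) - f xstar).

Definition Wpot (R : realType) (d : nat) (f : 'cV[R]_d -> R)
    (theta1 theta2 p : R) (xstar : 'cV[R]_d) (S : iterates R d) : R :=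
  theta2 * (1 + theta1) / (p * theta1) * (f (wit S) - f xstar).

(* Main.v *)
Require Import Defs.
From HB Require Import structures.
From mathcomp Require Import all_boot all_order all_algebra.
From mathcomp Require Import all_classical all_reals all_analysis.
From mathcomp Require Import ring lra.

Set Implicit Arguments.
Unset Strict Implicit.
Unset Printing Implicit Defensive.

Import Order.TTheory GRing.Theory Num.Theory.
Import numFieldNormedType.Exports.

Local Open Scope ring_scope.

(** The argument is a one-step Lyapunov analysis. Write f for the objective,
    c = Ltilde / eta, g for the gradient estimator at x = x^k, and
    D(w, x) = f(w) - f(x) - <grad f(x), w - x> for the Bregman divergence.

    For every outcome of the draw, z^{k+1} is a proximal step, so that
    g = c (z^k - z^{k+1}) + mu (x - z^{k+1}) and the three-point identity
    [prox_three_point] compares ||z^{k+1} - x*|| with ||z^k - x*||. The step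
    y^{k+1} - x = theta1 (z^{k+1} - z^k) is controlled by smoothness of f; the
    error <grad f(x) - g, z^{k+1} - z^k> is absorbed by Young's inequality, whose
    weight is dictated by the choice of eta. This gives [coupled_step_le], in
    which g enters only through <g, x* - z^k> and ||g - grad f(x)||^2.

    Averaging over the draw, the linear term becomes <grad f(x), x* - z^k>
    ([estimator_unbiased]) and the quadratic one is at most
    2 (Lbar / K) D(w^k, x) ([estimator_variance]): independence divides the
    variance by K, importance sampling makes the weight (s p_j)^-1 equal to
    Lbar / L_j, and [grad_diff_le_bregman] (co-coercivity) pays for the
    factor L_j. Since Lbar / K <= Ltilde, what remains of the variance is
    (theta2 / theta1) D(w^k, x). Its linear part cancels the w^k part of
    <grad f(x), x - z^k>, expanded along the definition of x, and the rest is
    strong convexity between x and x* and convexity between x and y^k. The coin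
    is averaged exactly, because neither z^{k+1} nor y^{k+1} depends on it.

    If Lbar = 0 the sampling law is identically zero, so that the left-hand side
    is 0 while every term on the right is nonnegative. *)

(** * Euclidean geometry of column vectors *)

Section Euclidean.
Context {R : realType} {d : nat}.
Implicit Types u v w : 'cV[R]_d.

Lemma dotvE u v : dotv u v = \sum_(i < d) u i 0 * v i 0.
Proof. by rewrite /dotv mxE; apply: eq_bigr => i _; rewrite mxE. Qed.

Lemma dotvC u v : dotv u v = dotv v u.
Proof. by rewrite !dotvE; apply: eq_bigr => i _; rewrite mulrC. Qed.

Lemma dotvDl u v w : dotv (u + v) w = dotv u w + dotv v w.
Proof. by rewrite /dotv linearD mulmxDl mxE. Qed.

Lemma dotvZl a u v : dotv (a *: u) v = a * dotv u v.
Proof. by rewrite /dotv linearZ -scalemxAl mxE. Qed.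

Lemma dotvNl u v : dotv (- u) v = - dotv u v.
Proof. by rewrite -scaleN1r dotvZl mulN1r. Qed.

Lemma dotv0l v : dotv 0 v = 0.
Proof. by rewrite -(scale0r 0) dotvZl mul0r. Qed.

Lemma dotv_suml (I : finType) (F : I -> 'cV[R]_d) v :
  dotv (\sum_i F i) v = \sum_i dotv (F i) v.
Proof.
by rewrite (big_morph (fun u => dotv u v) (fun u w => dotvDl u w v) (dotv0l v)).
Qed.

Lemma dotvDr u v w : dotv w (u + v) = dotv w u + dotv w v.
Proof. by rewrite dotvC dotvDl !(dotvC _ w). Qed.

Lemma dotvZr a u v : dotv v (a *: u) = a * dotv v u.
Proof. by rewrite dotvC dotvZl dotvC. Qed.

Lemma dotvNr u v : dotv v (- u) = - dotv v u.
Proof. by rewrite dotvC dotvNl dotvC. Qed.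

Definition dotv_linear :=
  (dotvDl, dotvDr, dotvNl, dotvNr, dotvZl, dotvZr).

Lemma dotv_ge0 u : 0 <= dotv u u.
Proof. by rewrite dotvE; apply: sumr_ge0 => i _; rewrite -expr2 sqr_ge0. Qed.

Lemma enorm_sqr u : enorm u ^+ 2 = dotv u u.
Proof. by rewrite /enorm sqr_sqrtr // dotv_ge0. Qed.

Lemma dotv_eq0 u : dotv u u = 0 -> u = 0.
Proof.
rewrite dotvE => /eqP; rewrite psumr_eq0 => [/allP u0|i _]; last first.
  by rewrite -expr2 sqr_ge0.
apply/colP => i; rewrite mxE; apply/eqP.
by have := u0 i (mem_index_enum i); rewrite mulf_eq0 orbb.
Qed.

Lemma enormZ a u : 0 <= a -> enorm (a *: u) = a * enorm u.
Proof.
move=> a0; rewrite /enorm !dotv_linear mulrA -expr2 sqrtrM ?sqr_ge0 //.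
by rewrite sqrtr_sqr ger0_norm.
Qed.

(** Expand 0 <= ||u - a v||^2 and divide by 2a. *)
Lemma young_dotv a u v : 0 < a ->
  dotv u v <= (2 * a)^-1 * dotv u u + a / 2 * dotv v v.
Proof.
move=> a0; have := dotv_ge0 (u - a *: v).
rewrite !dotv_linear (dotvC v u) => h.
have {h} : 0 <= (2 * a)^-1 * (dotv u u - a * dotv u v
    + (- (a * dotv u v) - - (a * (a * dotv v v)))).
  apply: mulr_ge0; last by lra.
  by rewrite invr_ge0; lra.
suff -> : (2 * a)^-1 * (dotv u u - a * dotv u v
    + (- (a * dotv u v) - - (a * (a * dotv v v)))) =
    (2 * a)^-1 * dotv u u + a / 2 * dotv v v - dotv u v by lra.
by field; lra.
Qed.

(** The Cauchy-Schwarz inequality in the form that the descent lemma uses; it is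
    Young's inequality with weight L. *)
Lemma dotv_le_of_enorm_le L u v : 0 <= L ->
  enorm u <= L * enorm v -> dotv u v <= L * enorm v ^+ 2.
Proof.
move=> L0 uv.
have uv2 : dotv u u <= L ^+ 2 * dotv v v.
  rewrite -!enorm_sqr -exprMn; apply: lerXn2r => //; rewrite nnegrE.
    exact: sqrtr_ge0.
  by rewrite mulr_ge0 // sqrtr_ge0.
have [L_eq0|L_neq0] := eqVneq L 0.
  move: uv2; rewrite L_eq0 expr0n mul0r => u0.
  have /dotv_eq0 -> : dotv u u = 0 by apply/eqP; rewrite eq_le u0 dotv_ge0.
  by rewrite dotv0l mul0r.
have Lgt0 : 0 < L by rewrite lt_neqAle eq_sym L_neq0.
apply: (le_trans (young_dotv u v Lgt0)); rewrite enorm_sqr.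
have -> : L * dotv v v = (2 * L)^-1 * (L ^+ 2 * dotv v v) + L / 2 * dotv v v.
  by field.
by rewrite lerD2r ler_wpM2l // invr_ge0; lra.
Qed.

End Euclidean.

(** * Gradients along lines *)

Section Calculus.
Context {R : realType} {d : nat}.
Implicit Types (h : 'cV[R]_d -> R) (x y v w : 'cV[R]_d).

Lemma derive_grad h x v : differentiable h x -> 'D_v h x = dotv (grad h x) v.
Proof.
move=> dh; rewrite deriveE // [in LHS](matrix_sum_delta v) dotvE linear_sum /=.
apply: eq_bigr => i _; rewrite big_ord1 linearZ /= mxE deriveE //.
by rewrite mulrC.
Qed.

Lemma is_derive_line h x v (t : R) : differentiable h (x + t *: v) ->
  is_derive t 1 (fun r : R => h (x + r *: v)) (dotv (grad h (x + t *: v)) v).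
Proof.
move=> dh.
have dl : is_diff t (fun r : R => x + r *: v) ( *:%R^~ v).
  rewrite [X in is_diff _ _ X](_ : _ = (0 : R -> 'cV[R]_d) \+ ( *:%R^~ v)).
    by apply: is_diffD.
  by apply/funext => r /=; rewrite add0r.
have dcmp : differentiable (h \o (fun r : R => x + r *: v)) t.
  exact: differentiable_comp.
apply: DeriveDef; first exact: diff_derivable.
rewrite -derive_grad // !deriveE // diff_comp //=.
by rewrite [X in 'd h _ (X 1)](@diff_val _ _ _ _ _ _ _ dl) scale1r.
Qed.

(** Along the segment from x to y, h minus its linearization at x minus the
    quadratic L/2 ||t (y - x)||^2 has nonpositive derivative, so the mean value
    theorem shows that it does not increase from t = 0 to t = 1. *)
Lemma lipschitz_gradient_descent L h x y : lipschitz_gradient L h ->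
  h y <= h x + dotv (grad h x) (y - x) + L / 2 * enorm (y - x) ^+ 2.
Proof.
move=> [L0 dh lh]; set v := y - x.
pose psi t : R := h (x + t *: v) - t * dotv (grad h x) v
  - t ^+ 2 * (L / 2 * enorm v ^+ 2).
pose dpsi t : R := dotv (grad h (x + t *: v)) v - dotv (grad h x) v
  - (2 * t) * (L / 2 * enorm v ^+ 2).
have dpsiE (t : R) : is_derive t (1 : R) psi (dpsi t).
  have dline := is_derive_line (dh (x + t *: v)).
  have -> : psi = (fun r : R => h (x + r *: v)) - dotv (grad h x) v \*: (@id R)
      - (L / 2 * enorm v ^+ 2) \*: (fun r : R => r ^+ 2).
    apply/funext => r; rewrite /psi !fctE /=.
    by congr (_ - _ - _); rewrite mulrC.
  apply: is_derive_eq.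
  by rewrite /dpsi /GRing.scale /=; ring.
have cpsi : {within `[0 : R, 1 : R], continuous psi}%classic.
  apply: continuous_subspaceT => t.
  by apply: differentiable_continuous; apply/derivable1_diffP; have [] := dpsiE t.
have [t /itvP t01] := MVT_segment ler01 (fun t _ => dpsiE t) cpsi.
rewrite subr0 mulr1 => psi01.
have dpsi_le0 : dpsi t <= 0.
  have : dotv (grad h (x + t *: v) - grad h x) v <= L * t * enorm v ^+ 2.
    apply: dotv_le_of_enorm_le; first by rewrite mulr_ge0 // t01.
    have := lh x (x + t *: v); rewrite [X in _ <= L * enorm X]addrC addKr.
    by rewrite enormZ ?t01 // mulrA.
  by rewrite /dpsi !dotv_linear; lra.
move: dpsi_le0; rewrite -psi01 /psi scale1r scale0r addr0.
have -> : x + v = y by rewrite /v addrC subrK.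
by lra.
Qed.

Definition first_order_convex h :=
  forall x y, h x + dotv (grad h x) (y - x) <= h y.

(** Convexity bounds the difference quotients of h at x towards y by h y - h x;
    their limit from the right is the directional derivative. *)
Lemma convex_first_order h : (forall x, differentiable h x) ->
  convex_function [set: 'cV[R]_d]%classic h -> first_order_convex h.
Proof.
move=> dh ch x y.
rewrite -derive_grad // addrC -lerBrDr.
have /cvg_ex[l hl] : derivable h x (y - x) by apply: diff_derivable.
rewrite /derive (cvg_lim _ hl) //.
have hl' := cvg_dnbhs_at_right hl.
apply: (cvgr_to_le hl'); near=> t.
have t0 : 0 < t by near: t; exact: nbhs_right_gt.
have t1 : t <= 1 by near: t; apply: nbhs_right_ltW.
have t01 : 0 <= t <= 1 by rewrite (ltW t0).
have := ch (Itv01 (ltW t0) t1) y x; rewrite !in_setT => /(_ isT isT) /=.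
rewrite /conv /= => hc.
have {}hc : h (t *: (y - x) + x) <= t * h y + (1 - t) * h x.
  have -> : t *: (y - x) + x = t *: y + (1 - t) *: x.
    by rewrite scalerBr scalerBl scale1r -addrA [- _ + x]addrC.
  exact: hc.
rewrite -(ler_pM2l t0) mulrA mulfV ?gt_eqF // mul1r.
by rewrite mulrBr; lra.
Unshelve. all: by end_near. Qed.

End Calculus.

(** * Co-coercivity of the gradient *)

Section Bregman.
Context {R : realType} {d : nat}.
Implicit Types (h : 'cV[R]_d -> R) (x y v w : 'cV[R]_d).

Definition bregman h w x := h w - h x - dotv (grad h x) (w - x).

(** Compare two bounds on h at u = w - L^-1 (grad h w - grad h x), the point that
    a gradient step from w reaches on h minus its linearization at x: convexity
    at x bounds h u below, the descent lemma at w bounds it above. *)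
Lemma grad_diff_le_bregman L h w x : lipschitz_gradient L h ->
  first_order_convex h ->
  enorm (grad h w - grad h x) ^+ 2 <= 2 * L * bregman h w x.
Proof.
move=> hL hc; have [L0 _ lh] := hL.
(* For L = 0 the step of length L^-1 is meaningless, but the gradient is
   constant. *)
have [L_eq0|L_neq0] := eqVneq L 0.
  have := lh x w; rewrite L_eq0 mul0r mulr0 mul0r => g0.
  have -> : enorm (grad h w - grad h x) = 0.
    by apply/eqP; rewrite eq_le g0 sqrtr_ge0.
  by rewrite expr0n.
have Lgt0 : 0 < L by rewrite lt_neqAle eq_sym L_neq0.
have [g gE] : exists g, g = grad h w - grad h x by exists (grad h w - grad h x).
rewrite -gE; pose u := w - L^-1 *: g.
have lower := hc x u.
have := lipschitz_gradient_descent w u hL.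
have -> : u - w = - (L^-1 *: g) by rewrite /u addrC addKr.
have ux : u - x = (w - x) - L^-1 *: g by rewrite /u addrAC.
move: lower; rewrite ux !enorm_sqr /bregman !dotv_linear => lower upper.
have gg : dotv g g = dotv (grad h w) g - dotv (grad h x) g.
  by rewrite {1}gE !dotv_linear.
have inv2L : L / 2 * (L^-1 * (L^-1 * dotv g g)) = L^-1 * dotv g g / 2.
  by field; lra.
move: lower upper; rewrite !mulrN !opprK inv2L => lower upper.
have inv_gg : L^-1 * dotv g g
    = L^-1 * dotv (grad h w) g - L^-1 * dotv (grad h x) g.
  by rewrite gg mulrBr.
have : L^-1 * dotv g g
    <= 2 * (h w - h x - (dotv (grad h x) w - dotv (grad h x) x)) by lra.
by rewrite ler_pdivrMl //; lra.
Qed.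

End Bregman.

(** * Independent sampling from a finite law *)

Section IidExpectation.
Context {R : realType} {K : nat} {T : finType} (q : T -> R).
Implicit Types (F G : {ffun 'I_K -> T} -> R) (phi psi : T -> R).

Definition iid_expectation F :=
  \sum_(J : {ffun 'I_K -> T}) (\prod_(i < K) q (J i)) * F J.

Local Notation E := iid_expectation.

Lemma iid_expectationD F G : E (fun J => F J + G J) = E F + E G.
Proof. by rewrite /E -big_split; apply: eq_bigr => J _; rewrite mulrDr. Qed.

Lemma iid_expectationZ a F : E (fun J => a * F J) = a * E F.
Proof. by rewrite /E mulr_sumr; apply: eq_bigr => J _; rewrite mulrCA. Qed.

Lemma iid_expectation_sum (I : finType) (F : I -> {ffun 'I_K -> T} -> R) :
  E (fun J => \sum_i F i J) = \sum_i E (F i).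
Proof.
by rewrite /E exchange_big; apply: eq_bigr => J _; rewrite mulr_sumr.
Qed.

Lemma eq_iid_expectation F G : F =1 G -> E F = E G.
Proof. by move=> FG; apply: eq_bigr => J _; rewrite FG. Qed.

Lemma le_iid_expectation F G : (forall j, 0 <= q j) ->
  (forall J, F J <= G J) -> E F <= E G.
Proof.
by move=> q0 FG; apply: ler_sum => J _; rewrite ler_wpM2l // prodr_ge0.
Qed.

(** Independence, as distributivity of the product over the sum. *)
Lemma iid_expectation_prod (phi : 'I_K -> T -> R) :
  E (fun J => \prod_i phi i (J i)) = \prod_i \sum_j q j * phi i j.
Proof.
rewrite bigA_distr_bigA /=; apply: eq_bigr => J _.
by rewrite -big_split.
Qed.

Hypothesis q_sum1 : \sum_j q j = 1.

Lemma iid_expectation_cst a : E (fun=> a) = a.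
Proof.
have := iid_expectation_prod (fun _ _ => 1).
rewrite [RHS]big1 => [E1|i _]; last first.
  by under eq_bigr do rewrite mulr1.
rewrite -[RHS]mulr1 -[in RHS]E1 -iid_expectationZ.
by apply: eq_iid_expectation => J; rewrite big1 ?mulr1.
Qed.

Lemma iid_expectation_marginal i phi :
  E (fun J => phi (J i)) = \sum_j q j * phi j.
Proof.
transitivity (E (fun J => \prod_i' (if i' == i then phi (J i') else 1))).
  apply: eq_iid_expectation => J.
  by rewrite -big_mkcond big_pred1_eq.
rewrite (iid_expectation_prod (fun i' j => if i' == i then phi j else 1)).
rewrite (bigD1 i) //= eqxx [X in _ * X]big1 ?mulr1 // => i' /negbTE ->.
by under eq_bigr do rewrite mulr1.
Qed.

Lemma iid_expectation_indep i1 i2 phi psi : i1 != i2 ->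
  E (fun J => phi (J i1) * psi (J i2))
  = (\sum_j q j * phi j) * \sum_j q j * psi j.
Proof.
move=> i12.
pose F i j := if i == i1 then phi j else if i == i2 then psi j else 1.
transitivity (E (fun J => \prod_i F i (J i))).
  apply: eq_iid_expectation => J.
  rewrite (bigD1 i1) //= (bigD1 i2) 1?eq_sym //= /F eqxx eq_sym (negbTE i12) eqxx.
  by rewrite big1 ?mulr1 // => i /andP[/negbTE -> /negbTE ->].
rewrite iid_expectation_prod (bigD1 i1) //= (bigD1 i2) 1?eq_sym //=.
rewrite /F eqxx eq_sym (negbTE i12) eqxx [X in _ * (_ * X)]big1 ?mulr1 //.
move=> i /andP[/negbTE -> /negbTE ->].
by under eq_bigr do rewrite mulr1.
Qed.

(** The cross terms of the expanded square vanish by independence and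
    centering. *)
Lemma iid_expectation_sqr_sum phi : \sum_j q j * phi j = 0 ->
  E (fun J => (\sum_i phi (J i)) ^+ 2) = K%:R * \sum_j q j * phi j ^+ 2.
Proof.
move=> phi0.
transitivity (E (fun J => \sum_i \sum_i' phi (J i) * phi (J i'))).
  apply: eq_iid_expectation => J; rewrite expr2 mulr_suml.
  by apply: eq_bigr => i _; rewrite mulr_sumr.
rewrite iid_expectation_sum.
transitivity (\sum_(i < K) \sum_j q j * phi j ^+ 2); last first.
  by rewrite sumr_const card_ord mulr_natl.
apply: eq_bigr => i _; rewrite iid_expectation_sum (bigD1 i) //=.
rewrite [X in _ + X]big1 => [|i' ii']; last first.
  by rewrite iid_expectation_indep 1?eq_sym // phi0 mul0r.
by rewrite addr0 (iid_expectation_marginal i (fun j => phi j * phi j)).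
Qed.

Variables (d : nat) (X : T -> 'cV[R]_d) (c : 'cV[R]_d).

(** The offset c is part of the definition because the estimator of the algorithm
    is the full gradient at w plus a minibatch correction. *)
Definition sample_mean (J : {ffun 'I_K -> T}) := K%:R^-1 *: \sum_i X (J i) + c.

Let m := \sum_j q j *: X j.

Lemma iid_expectation_dotv_sample_mean v : (0 < K)%N ->
  E (fun J => dotv (sample_mean J) v) = dotv (m + c) v.
Proof.
move=> K0; rewrite dotvDl -(iid_expectation_cst (dotv c v)).
transitivity (E (fun J => K%:R^-1 * \sum_i dotv (X (J i)) v + dotv c v)).
  by apply: eq_iid_expectation => J; rewrite !dotv_linear dotv_suml.
rewrite iid_expectationD iid_expectationZ iid_expectation_sum; congr (_ + _).
under eq_bigr do rewrite (iid_expectation_marginal _ (fun j => dotv (X j) v)).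
rewrite sumr_const card_ord -[X in _ * X]mulr_natl mulKf ?pnatr_eq0 -?lt0n // /m dotv_suml.
by apply: eq_bigr => j _; rewrite dotvZl.
Qed.

(** Coordinatewise, the variance of the mean of K draws is 1/K times that of one
    draw, and a variance is at most the second moment. *)
Lemma iid_variance_sample_mean_le : (0 < K)%N -> (forall j, 0 <= q j) ->
  E (fun J => enorm (sample_mean J - (m + c)) ^+ 2)
  <= K%:R^-1 * \sum_j q j * enorm (X j) ^+ 2.
Proof.
move=> K0 q0; have KR0 : (K%:R : R) != 0 by rewrite pnatr_eq0 -lt0n.
pose Xc j := X j - m.
have Xc0 a : \sum_j q j * Xc j a 0 = 0.
  under eq_bigr do rewrite /Xc mxE mulrDr.
  rewrite big_split /= -mulr_suml q_sum1 mul1r mxE summxE.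
  by under [in X in _ - X]eq_bigr do rewrite mxE; rewrite subrr.
have centre J : sample_mean J - (m + c) = K%:R^-1 *: \sum_i Xc (J i).
  rewrite /sample_mean /Xc sumrB sumr_const card_ord scalerBr -[m *+ _]scaler_nat.
  by rewrite scalerA mulVf // scale1r opprD addrACA addrN addr0.
have EXc : E (fun J => enorm (sample_mean J - (m + c)) ^+ 2)
    = K%:R^-1 * \sum_j q j * enorm (Xc j) ^+ 2.
  transitivity (E (fun J => K%:R^-1 ^+ 2 *
      \sum_(a < d) (\sum_i Xc (J i) a 0) ^+ 2)).
    apply: eq_iid_expectation => J; rewrite centre enorm_sqr !dotv_linear mulrA.
    congr (_ * _); rewrite dotvE; apply: eq_bigr => a _.
    by rewrite summxE expr2.
  rewrite iid_expectationZ iid_expectation_sum.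
  under eq_bigr do rewrite (iid_expectation_sqr_sum (Xc0 _)).
  rewrite -mulr_sumr mulrA expr2 -[_ * _ * K%:R]mulrA mulVf // mulr1; congr (_ * _).
  rewrite exchange_big; apply: eq_bigr => j _.
  by rewrite -mulr_sumr enorm_sqr dotvE; under eq_bigr do rewrite expr2.
rewrite EXc ler_wpM2l ?invr_ge0 ?ler0n //.
have -> : \sum_j q j * enorm (Xc j) ^+ 2
    = \sum_j q j * enorm (X j) ^+ 2 - dotv m m.
  transitivity (\sum_j (q j * enorm (X j) ^+ 2
      - 2 * dotv (q j *: X j) m + q j * dotv m m)).
    apply: eq_bigr => j _; rewrite !enorm_sqr /Xc !dotv_linear (dotvC m).
    by ring.
  rewrite big_split sumrB /= -mulr_suml q_sum1 -mulr_sumr -dotv_suml -/m.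
  by ring.
by rewrite gerBl dotv_ge0.
Qed.

End IidExpectation.

(** * The finite-sum objective *)

Section Objective.
Context {R : realType} {s d : nat}.
Variables (A : 'M[R]_(s, d)) (b : 'cV[R]_s) (loss : 'I_s -> R -> R -> R).

Local Notation f := (objective A b loss).
Local Notation fj := (sample_loss A b loss).

Lemma grad_objective x : (forall j, differentiable (fj j) x) ->
  grad f x = s%:R^-1 *: \sum_j grad (fj j) x.
Proof.
move=> df; apply/colP => i; rewrite !mxE summxE.
have -> : f = s%:R^-1 \*: \sum_(j < s) (fj j : 'cV[R]_d -> R).
  by apply/funext => y; rewrite /objective /= fct_sumE.
rewrite deriveZ; last by apply: derivable_sum => j; apply: diff_derivable.
rewrite derive_sum; last by move=> j; apply: diff_derivable.
by congr (_ * _); apply: eq_bigr => j _; rewrite mxE.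
Qed.

Lemma bregman_objective w x : (forall j, differentiable (fj j) x) ->
  bregman f w x = s%:R^-1 * \sum_j bregman (fj j) w x.
Proof.
move=> df; rewrite /bregman grad_objective // dotvZl dotv_suml !sumrB.
by rewrite /objective; ring.
Qed.

Lemma objective_smooth L x y : (0 < s)%N -> (forall j, smooth L (fj j)) ->
  f y <= f x + dotv (grad f x) (y - x) + L / 2 * enorm (y - x) ^+ 2.
Proof.
move=> s0 fs.
suff : bregman f y x <= L / 2 * enorm (y - x) ^+ 2 by rewrite /bregman; lra.
have sR0 : 0 < s%:R :> R by rewrite ltr0n.
rewrite bregman_objective => [|j]; last exact: (fs j).1.
rewrite ler_pdivrMl // mulr_natl -[X in _ *+ X]card_ord -sumr_const.
by apply: ler_sum => j _; have := (fs j).2 x y; rewrite /bregman; lra.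
Qed.

End Objective.

(** * The importance-sampled gradient estimator *)

Section Estimator.
Context {R : realType} {s d K : nat}.
Variables (A : 'M[R]_(s, d)) (b : 'cV[R]_s) (loss : 'I_s -> R -> R -> R).
Variables (Lj : 'I_s -> R).
Hypotheses (s_gt0 : (0 < s)%N) (K_gt0 : (0 < K)%N).
Hypothesis loss_lipschitz :
  forall j, lipschitz_gradient (Lj j) (sample_loss A b loss j).
Hypothesis loss_convex : forall j, first_order_convex (sample_loss A b loss j).
Hypothesis Lbar_gt0 : 0 < Lbar Lj.

Local Notation f := (objective A b loss).
Local Notation fj := (sample_loss A b loss).
Local Notation prob := (sampling_prob Lj).
Local Notation E := (@iid_expectation R K 'I_s (sampling_prob Lj)).

Let sR_gt0 : 0 < s%:R :> R. Proof. by rewrite ltr0n. Qed.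

Let Lj_ge0 j : 0 <= Lj j. Proof. by case: (loss_lipschitz j). Qed.

Let diff_fj j x : differentiable (fj j) x.
Proof. by case: (loss_lipschitz j). Qed.

Lemma sampling_prob_ge0 j : 0 <= prob j.
Proof. by rewrite /sampling_prob divr_ge0 // mulr_ge0 // ltW. Qed.

Lemma sampling_prob_sum1 : \sum_j prob j = 1.
Proof.
rewrite /sampling_prob -mulr_suml.
have -> : \sum_j Lj j = s%:R * Lbar Lj by rewrite /Lbar mulVKf // gt_eqF.
by rewrite divff // mulf_neq0 ?gt_eqF.
Qed.

Definition scaled_grad_diff x w j : 'cV[R]_d :=
  (s%:R * prob j)^-1 *: (grad (fj j) x - grad (fj j) w).

(** Makes the conventional weight 0 of a sample with L_j = 0 harmless: such a
    sample has nothing to contribute to the estimator. *)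
Lemma grad_diff_eq0 x w j : Lj j = 0 -> grad (fj j) x - grad (fj j) w = 0.
Proof.
move=> Lj0; have [_ _ /(_ w x)] := loss_lipschitz j; rewrite Lj0 mul0r => g0.
apply: dotv_eq0; rewrite -enorm_sqr; apply/eqP.
by rewrite expf_eq0 /= eq_le g0 sqrtr_ge0.
Qed.

Lemma mean_scaled_grad_diff x w :
  \sum_j prob j *: scaled_grad_diff x w j + grad f w = grad f x.
Proof.
have -> : \sum_j prob j *: scaled_grad_diff x w j
    = \sum_j s%:R^-1 *: (grad (fj j) x - grad (fj j) w).
  apply: eq_bigr => j _; rewrite /scaled_grad_diff scalerA.
  have [Lj0|Lj_neq0] := eqVneq (Lj j) 0; first by rewrite grad_diff_eq0 ?scaler0.
  by congr (_ *: _); rewrite /sampling_prob; field; rewrite Lj_neq0 !gt_eqF.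
by rewrite -scaler_sumr sumrB scalerBr !grad_objective // subrK.
Qed.

Lemma estimator_unbiased x w v :
  E (fun J => dotv (estimator A b loss Lj J x w) v) = dotv (grad f x) v.
Proof.
rewrite -(mean_scaled_grad_diff x w).
exact: (iid_expectation_dotv_sample_mean sampling_prob_sum1).
Qed.

(** The second moment of one draw is the sum of
    Lbar / (s L_j) ||grad f_j x - grad f_j w||^2, and co-coercivity bounds each
    squared norm by 2 L_j times the divergence of f_j, so that L_j cancels. *)
Lemma estimator_variance x w :
  E (fun J => enorm (estimator A b loss Lj J x w - grad f x) ^+ 2)
  <= 2 * (Lbar Lj / K%:R) * bregman f w x.
Proof.
rewrite -{1}(mean_scaled_grad_diff x w).
apply: (le_trans (iid_variance_sample_mean_le sampling_prob_sum1 _ _ K_gt0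
  sampling_prob_ge0)).
have -> : 2 * (Lbar Lj / K%:R) * bregman f w x
    = K%:R^-1 * \sum_j 2 * Lbar Lj / s%:R * bregman (fj j) w x.
  by rewrite bregman_objective // -mulr_sumr; ring.
rewrite ler_wpM2l ?invr_ge0 ?ler0n //; apply: ler_sum => j _.
have breg_ge0 : 0 <= bregman (fj j) w x.
  by have := loss_convex j x w; rewrite /bregman; lra.
have Lbar_ge0 := ltW Lbar_gt0.
rewrite enorm_sqr /scaled_grad_diff dotvZl dotvZr -enorm_sqr.
have [Lj0|Lj_neq0] := eqVneq (Lj j) 0.
  by rewrite /sampling_prob Lj0 !mul0r mulr_ge0 // divr_ge0 // mulr_ge0.
have Lj_gt0 : 0 < Lj j by rewrite lt_neqAle eq_sym Lj_neq0 Lj_ge0.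
have -> : prob j * ((s%:R * prob j)^-1 * ((s%:R * prob j)^-1 *
    enorm (grad (fj j) x - grad (fj j) w) ^+ 2))
  = Lbar Lj / s%:R / Lj j * enorm (grad (fj j) x - grad (fj j) w) ^+ 2.
  by rewrite /sampling_prob; field; rewrite !gt_eqF.
have -> : 2 * Lbar Lj / s%:R * bregman (fj j) w x
  = Lbar Lj / s%:R / Lj j * (2 * Lj j * bregman (fj j) w x).
  by field; rewrite !gt_eqF.
apply: ler_wpM2l; first by rewrite !divr_ge0.
have -> : enorm (grad (fj j) x - grad (fj j) w)
    = enorm (grad (fj j) w - grad (fj j) x).
  by rewrite -opprB /enorm dotvNl dotvNr opprK.
exact: grad_diff_le_bregman.
Qed.

End Estimator.

(** * One iteration for a fixed draw *)

Section OneDraw.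
Context {R : realType} {d : nat}.
Implicit Types (f : 'cV[R]_d -> R) (x z g xs : 'cV[R]_d).

(** The two sides differ by mu/2 ||x - z'||^2: apply the polarization identity to
    both inner products in <g, xs - z'>. *)
Lemma prox_three_point c mu x z (z' : 'cV[R]_d) xs g : 0 <= mu ->
  g = c *: (z - z') + mu *: (x - z') ->
  c / 2 * enorm (z' - z) ^+ 2 + (c + mu) / 2 * enorm (z' - xs) ^+ 2
  <= c / 2 * enorm (z - xs) ^+ 2 + mu / 2 * enorm (x - xs) ^+ 2
     + dotv g (xs - z').
Proof.
move=> mu0 ->; rewrite -subr_ge0.
have -> : c / 2 * enorm (z - xs) ^+ 2 + mu / 2 * enorm (x - xs) ^+ 2
     + dotv (c *: (z - z') + mu *: (x - z')) (xs - z')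
     - (c / 2 * enorm (z' - z) ^+ 2 + (c + mu) / 2 * enorm (z' - xs) ^+ 2)
   = mu / 2 * dotv (x - z') (x - z').
  rewrite !enorm_sqr !dotv_linear.
  rewrite (dotvC xs z) (dotvC xs z') (dotvC xs x) (dotvC z z') (dotvC x z').
  by field.
by rewrite mulr_ge0 ?dotv_ge0 // divr_ge0.
Qed.

(** The choice of the step size is what makes this work: with
    a = Ltilde theta1 / theta2 one has c = a + Ltilde theta1, so the term
    c/2 ||z' - z||^2 gained in the proximal step pays both for Young's inequality
    with weight a and for the quadratic term of the smoothness bound. *)
Lemma coupled_step_le f Lt mu theta1 theta2 x z (z' : 'cV[R]_d) xs g :
  0 < Lt -> 0 <= mu -> 0 < theta1 -> 0 < theta2 ->
  let c := Lt / step_size theta1 theta2 in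
  let y' := x + theta1 *: (z' - z) in
  f y' <= f x + dotv (grad f x) (y' - x) + Lt / 2 * enorm (y' - x) ^+ 2 ->
  g = c *: (z - z') + mu *: (x - z') ->
  (c + mu) / 2 * enorm (z' - xs) ^+ 2 + theta1^-1 * (f y' - f x)
  <= c / 2 * enorm (z - xs) ^+ 2 + mu / 2 * enorm (x - xs) ^+ 2
     + dotv g (xs - z)
     + theta2 / (2 * Lt * theta1) * enorm (g - grad f x) ^+ 2.
Proof.
move=> Lt0 mu0 th1 th2 c y' fy' gE.
have prox := prox_three_point xs mu0 gE.
have yx : y' - x = theta1 *: (z' - z) by rewrite /y' addrC addKr.
pose a := Lt * theta1 / theta2.
have a0 : 0 < a by rewrite divr_gt0 // mulr_gt0.
have young := young_dotv (grad f x - g) (z' - z) a0.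
have ca : c = a + Lt * theta1.
  by rewrite /c /a /step_size; field; rewrite !gt_eqF //; lra.
have descent : theta1^-1 * (f y' - f x)
    <= dotv (grad f x) (z' - z) + Lt * theta1 / 2 * dotv (z' - z) (z' - z).
  rewrite ler_pdivrMl //.
  by move: fy'; rewrite yx enorm_sqr dotvZl !dotvZr; lra.
have a_inv : (2 * a)^-1 = theta2 / (2 * Lt * theta1).
  by rewrite /a; field; rewrite !gt_eqF.
have -> : enorm (g - grad f x) ^+ 2 = dotv (grad f x - g) (grad f x - g).
  by rewrite enorm_sqr -opprB dotvNl dotvNr opprK.
have split_g : dotv g (xs - z') + dotv g (z' - z) = dotv g (xs - z).
  by rewrite -dotvDr addrA subrK.
have split_grad : dotv (grad f x - g) (z' - z)
    = dotv (grad f x) (z' - z) - dotv g (z' - z) by rewrite dotvDl dotvNl.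
rewrite -a_inv.
move: prox; rewrite (enorm_sqr (z' - z)) {1}ca.
lra.
Qed.

End OneDraw.


(** * The Lyapunov inequality *)

Lemma sigma_paramE (R : realType) (s K : nat) (L mu : R) (Lj : 'I_s -> R) :
  0 < L -> (0 < K)%N -> sigma_param K L mu Lj = mu / Ltilde K L Lj.
Proof.
move=> L0 K0; rewrite /sigma_param /Ltilde.
case: (leP L (Lbar Lj / K%:R)) => // LK.
by rewrite invf_div mulrCA mulrA.
Qed.


Theorem theorem2 (R : realType) (s d K : nat)
    (A : 'M[R]_(s, d)) (b : 'cV[R]_s) (loss : 'I_s -> R -> R -> R)
    (L mu : R) (Lj : 'I_s -> R) (theta1 theta2 p : R) (xstar : 'cV[R]_d)
    (s_gt0 : (0 < s)%N) (K_gt0 : (0 < K)%N)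
    (L_gt0 : 0 < L) (mu_gt0 : 0 < mu)
    (loss_convex : forall j : 'I_s,
       convex_function [set: 'cV[R]_d]%classic (sample_loss A b loss j))
    (loss_smooth : forall j : 'I_s, smooth L (sample_loss A b loss j))
    (loss_lipschitz : forall j : 'I_s,
       lipschitz_gradient (Lj j) (sample_loss A b loss j))
    (f_strongly_convex : strongly_convex mu (objective A b loss))
    (xstar_min : forall x : 'cV[R]_d,
       objective A b loss xstar <= objective A b loss x)
    (theta1_gt0 : 0 < theta1) (theta2_gt0 : 0 < theta2)
    (theta_le1 : theta1 + theta2 <= 1)
    (p_gt0 : 0 < p) (p_le1 : p <= 1)
    (x0 : 'cV[R]_d) (J : nat -> {ffun 'I_K -> 'I_s}) (c : nat -> bool)
    (k : nat) :
  let f := objective A b loss in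
  let es := step_size theta1 theta2 * sigma_param K L mu Lj in
  let Z := Zpot K L mu Lj theta1 theta2 xstar in
  let Y := Ypot f theta1 xstar in
  let W := Wpot f theta1 theta2 p xstar in
  let S := katyusha_iter A b loss L mu Lj theta1 theta2 x0 J c k in
  iteration_expectation Lj p (fun (Jk : {ffun 'I_K -> 'I_s}) (ck : bool) =>
    let S' := katyusha_step A b loss L mu Lj theta1 theta2 S Jk ck in
    Z S' + Y S' + W S')
  <= (1 + es)^-1 * Z S
     + (1 - theta1 * (1 - theta2)) * Y S
     + (1 - p * theta1 / (1 + theta1)) * W S.
Proof.
cbv zeta; set f := objective A b loss.
set es := step_size theta1 theta2 * sigma_param K L mu Lj.
set Z := Zpot K L mu Lj theta1 theta2 xstar.
set Y := Ypot f theta1 xstar; set W := Wpot f theta1 theta2 p xstar.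
set S := katyusha_iter A b loss L mu Lj theta1 theta2 x0 J c k.
have dfj j x : differentiable (sample_loss A b loss j) x.
  by case: (loss_lipschitz j).
have fj_convex j : first_order_convex (sample_loss A b loss j).
  exact: convex_first_order.
have f_convex : first_order_convex f.
  move=> x y; apply: le_trans (f_strongly_convex.2 x y).
  by rewrite lerDl mulr_ge0 ?sqr_ge0 // divr_ge0 // ltW.
have bregman_ge0 v u : 0 <= bregman f v u.
  by have := f_convex u v; rewrite /bregman; lra.
have eta_gt0 : 0 < step_size theta1 theta2.
  by rewrite divr_gt0 // mulr_gt0 // addr_gt0.
set Lt := Ltilde K L Lj.
have Lt_gt0 : 0 < Lt by rewrite lt_max L_gt0.
have esE : es = step_size theta1 theta2 * (mu / Lt).
  by rewrite /es sigma_paramE.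
have es_gt0 : 0 < es by rewrite esE mulr_gt0 // divr_gt0.
pose c0 := Lt / step_size theta1 theta2.
have c0_gt0 : 0 < c0 by rewrite divr_gt0.
have ZE S1 : Z S1 = (c0 + mu) / 2 * enorm (zit S1 - xstar) ^+ 2.
  rewrite /Z /Zpot -/es -/Lt esE; congr (_ * _); rewrite /c0.
  by field; rewrite !gt_eqF.
have ZE' S1 : (1 + es)^-1 * Z S1 = c0 / 2 * enorm (zit S1 - xstar) ^+ 2.
  rewrite /Z /Zpot -/es -/Lt mulrA; congr (_ * _); rewrite /c0.
  by field; rewrite !gt_eqF // addr_gt0.
(* If Lbar = 0, every product of sampling probabilities is 0; K > 0 is what
   provides a factor. *)
have [Lbar_le0|Lbar_gt0] := leP (Lbar Lj) 0.
  have Lbar0 : Lbar Lj = 0.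
    apply/eqP; rewrite eq_le Lbar_le0 mulr_ge0 ?invr_ge0 //.
    by apply: sumr_ge0 => j _; case: (loss_lipschitz j).
  have gap_ge0 v : 0 <= f v - f xstar by rewrite subr_ge0.
  rewrite /iteration_expectation big1 => [|Jk _]; last first.
    rewrite (bigD1 (Ordinal K_gt0)) //= {1}/sampling_prob Lbar0.
    by rewrite mulr0 invr0 mulr0 !mul0r.
  rewrite ZE' !addr_ge0 //.
  - by rewrite mulr_ge0 ?sqr_ge0 // mulr_ge0 ?invr_ge0 // ltW.
  - rewrite mulr_ge0 //; first by nra.
    by rewrite mulr_ge0 ?invr_ge0 //; exact: ltW.
  - rewrite mulr_ge0 //.
      rewrite subr_ge0 ler_pdivrMr ?addr_gt0 // mul1r.
      by nra.
    have W_coef_gt0 : 0 < theta2 * (1 + theta1) / (p * theta1).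
      by rewrite divr_gt0 ?mulr_gt0 ?addr_gt0.
    by rewrite mulr_ge0 // ltW.
set x := xit theta1 theta2 S; set w := wit S; set y := yit S; set z := zit S.
pose est (Jk : {ffun 'I_K -> 'I_s}) := estimator A b loss Lj Jk x w.
(* The exact average of the potential W over the coin. *)
pose coin := p * (theta2 * (1 + theta1) / (p * theta1) * (f y - f xstar))
  + (1 - p) * (theta2 * (1 + theta1) / (p * theta1) * (f w - f xstar)).
(* The part of the bound for a fixed draw that does not involve the draw. *)
pose C := c0 / 2 * enorm (z - xstar) ^+ 2 + mu / 2 * enorm (x - xstar) ^+ 2
  + theta1^-1 * (f x - f xstar) + coin.
have q_ge0 := sampling_prob_ge0 loss_lipschitz Lbar_gt0.
have q_sum1 := sampling_prob_sum1 s_gt0 Lbar_gt0.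
pose E := @iid_expectation R K 'I_s (sampling_prob Lj).
pose next (Jk : {ffun 'I_K -> 'I_s}) (ck : bool) :=
  let S' := katyusha_step A b loss L mu Lj theta1 theta2 S Jk ck in
  Z S' + Y S' + W S'.
have draw Jk : p * next Jk true + (1 - p) * next Jk false
  <= C + dotv (est Jk) (xstar - z)
     + theta2 / (2 * Lt * theta1) * enorm (est Jk - grad f x) ^+ 2.
  rewrite /next /=.
  pose S1 := katyusha_step A b loss L mu Lj theta1 theta2 S Jk true.
  pose S0 := katyusha_step A b loss L mu Lj theta1 theta2 S Jk false.
  rewrite -/S1 -/S0.
  pose z' := zit S1.
  have gE : est Jk = c0 *: (z - z') + mu *: (x - z').
    have zE : (1 + es) *: z' = es *: x + z
        - (step_size theta1 theta2 / Lt) *: est Jk.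
      by rewrite scalerA divff ?scale1r // gt_eqF // addr_gt0.
    have -> : mu = c0 * es by rewrite esE /c0; field; rewrite !gt_eqF.
    rewrite -scalerA -scalerDr scalerBr.
    have -> : z - z' + (es *: x - es *: z')
        = (step_size theta1 theta2 / Lt) *: est Jk.
      rewrite -[RHS](subKr (es *: x + z)) -zE scalerDl scale1r opprD addrACA.
      by rewrite [z + _]addrC.
    by rewrite scalerA /c0 mulrA divfK ?divff ?scale1r ?gt_eqF.
  have Ef := objective_smooth x (yit S1) s_gt0 loss_smooth.
  have Ef' : f (yit S1) <= f x + dotv (grad f x) (yit S1 - x)
      + Lt / 2 * enorm (yit S1 - x) ^+ 2.
    apply: (le_trans Ef); rewrite lerD2l ler_wpM2r ?sqr_ge0 //.
    by rewrite ler_wpM2r ?invr_ge0 // /Lt le_max lexx.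
  have := coupled_step_le xstar Lt_gt0 (ltW mu_gt0) theta1_gt0 theta2_gt0 Ef' gE.
  rewrite !ZE /C /coin /Y /W /Ypot /Wpot -/c0.
  have -> : zit S0 = z' by [].
  have -> : zit S1 = z' by [].
  have -> : yit S0 = yit S1 by [].
  have -> : wit S1 = y by [].
  have -> : wit S0 = w by [].
  lra.
have expected : E (fun Jk => p * next Jk true + (1 - p) * next Jk false)
  <= C + dotv (grad f x) (xstar - z)
     + theta2 / (2 * Lt * theta1) * (2 * Lt * bregman f w x).
  apply: (le_trans (le_iid_expectation q_ge0 draw)).
  rewrite 2!iid_expectationD iid_expectation_cst // iid_expectationZ.
  rewrite estimator_unbiased //.
  rewrite lerD2l ler_wpM2l //.
    by rewrite divr_ge0 ?mulr_ge0 // ltW // ?mulr_gt0.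
  apply: (le_trans (estimator_variance _ _ _ _ _ _ _)) => //.
  apply: ler_wpM2r; first exact: bregman_ge0.
  by rewrite ler_wpM2l // /Lt le_max lexx orbT.
apply: (le_trans expected).
rewrite ZE' /Y /W /Ypot /Wpot -/y -/w -/z /C /coin /bregman.
have sc : f x + dotv (grad f x) (xstar - x) + mu / 2 * enorm (xstar - x) ^+ 2
    <= f xstar by exact: f_strongly_convex.2.
have fxy := f_convex x y.
rewrite -subr_ge0.
(* The right-hand side exceeds the left-hand side exactly by r, the slack in
   strong convexity between x and xstar plus 1/theta1 times the weight of y in x
   times the slack in convexity between x and y. *)
pose r := (f xstar - f x - dotv (grad f x) (xstar - x)
     - mu / 2 * enorm (xstar - x) ^+ 2)
   + (1 - theta1 - theta2) / theta1 * (f y - f x - dotv (grad f x) (y - x)).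
have r_ge0 : 0 <= r.
  rewrite addr_ge0 //; first by lra.
  by rewrite mulr_ge0 //; [rewrite divr_ge0 //; lra | lra].
rewrite [leRHS](_ : _ = r) // {r_ge0}/r.
have -> : enorm (xstar - x) = enorm (x - xstar).
  by rewrite -opprB /enorm dotvNl dotvNr opprK.
rewrite !dotvDr !dotvNr.
have -> : dotv (grad f x) x = theta1 * dotv (grad f x) z
   + theta2 * dotv (grad f x) w + (1 - theta1 - theta2) * dotv (grad f x) y.
  by rewrite {2}/x /xit !dotvDr !dotvZr.
by field; rewrite !gt_eqF // addr_gt0.
Qed.
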